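(* Let $(E,\pi)$ be a Jordan Banach triple system. Then the extension $\pi^0:E^{**}\times E^{**}\times E^{**}\to E^{**}$ (equivalently, $\pi^2$) is symmetric in the outer variables if and only if $(E^{**},\pi^0)$ (equivalently, $(E^{**},\pi^2)$) is a Jordan Banach triple system.
   Context: Jordan Banach triple systems are taken complex: a complex Banach space $E$ with a jointly continuous map $\pi=\{\cdot,\cdot,\cdot\}:E\times E\times E\to E$ which is bilinear and symmetric in the outer variables, conjugate linear in the middle one, and satisfies the Jordan identity $\{a,b,\{c,d,e\}\}=\{\{a,b,c\},d,e\}-\{c,\{b,a,d\},e\}+\{c,d,\{a,b,e\}\}$ for all $a,b,c,d,e\in E$. The Aron--Berner extensions $\pi^0,\pi^2:E^{**}\times E^{**}\times E^{**}\to E^{**}$ of $\pi$ (bilinear in the outer variables, conjugate linear in the middle one) are given by iterated $w^*$-limits: for $m,n,p\in E^{**}$ and bounded nets $(m_{\alpha_1}),(n_{\alpha_2}),(p_{\alpha_3})$ in $E$ converging in the $w^*$-topology to $m,n,p$ respectively, $\pi^0(m,n,p)=w^*\text{-}\lim_{\alpha_1}\lim_{\alpha_2}\lim_{\alpha_3}\pi(m_{\alpha_1},n_{\alpha_2},p_{\alpha_3})$ and $\pi^2(m,n,p)=w^*\text{-}\lim_{\alpha_3}\lim_{\alpha_2}\lim_{\alpha_1}\pi(m_{\alpha_1},n_{\alpha_2},p_{\alpha_3})$ (all limits in the $w^*$-topology, the rightmost limit taken first; the results do not depend on the nets). A map $\rho:E^{**}\times E^{**}\times E^{**}\to E^{**}$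 is symmetric in the outer variables if $\rho(m,n,p)=\rho(p,n,m)$ for all $m,n,p\in E^{**}$. *)

(* Defs.v *)
From HB Require Import structures.
From mathcomp Require Import all_boot all_order all_algebra.
From mathcomp Require Import complex.
From mathcomp Require Import all_classical all_reals all_analysis.

Set Implicit Arguments.
Unset Strict Implicit.
Unset Printing Implicit Defensive.

Import Order.TTheory GRing.Theory Num.Theory.
Import numFieldNormedType.Exports.

Local Open Scope classical_set_scope.
Local Open Scope ring_scope.
Local Open Scope complex_scope.

Section complex_complete.
Variable R : realType.

Let normi : `|(0 +i* 1 : R[i])| = 1.
Proof. by rewrite normc_def/= expr0n/= add0r expr1n sqrtr1. Qed.

Lemma normc_Re_Im_le (z : R[i]) :
  `|z| <= (`|complex.Re z| + `|complex.Im z|)%:C.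
Proof.
rewrite {1}[z]complexE (le_trans (ler_normD _ _))// normrM normi mul1r.
by rewrite !normc_def/= !expr0n/= !addr0 !sqrtr_sqr rmorphD.
Qed.

Lemma complex_cauchy_cvg (F : set_system R[i]^o) :
  ProperFilter F -> cauchy F -> cvg F.
Proof.
move=> FF /cauchy_ballP Fc.
have aux (h : R[i]^o -> R) : (forall x y, `|h x - h y|%:C <= `|x - y|) ->
    cvg (h @ F).
  move=> hle; apply: R_complete; apply/cauchy_ballP => e e0.
  have e0' : 0 < e%:C :> R[i] by rewrite ltcR.
  have [[A B] [/= FA FB] AB] := Fc e%:C e0'.
  exists (h @` A, h @` B) => /=.
    by split; [apply: filterS FA | apply: filterS FB] => x ?; exists x.
  move=> [_ _] [/= [x Ax <-] [y By <-]].
  have := AB (x, y) (conj Ax By); rewrite /ball/= => H.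
  by rewrite -ltcR; exact: le_lt_trans H.
have /cvg_ex[a Fa] : cvg (@complex.Re R @ F).
  by apply: aux => x y; rewrite -raddfB; exact: normc_ge_Re.
have /cvg_ex[b Fb] : cvg (@complex.Im R @ F).
  apply: aux => x y; rewrite -raddfB -(normrN (complex.Im _)) -ReiNIm.
  by rewrite (le_trans (normc_ge_Re _))// normrM normi mulr1.
apply/cvg_ex; exists (a +i* b); apply/cvgrPdist_lt => e e0.
have er : (complex.Re e)%:C = e by rewrite RRe_real// gtr0_real.
have e2 : 0 < complex.Re e / 2 by rewrite divr_gt0// -ltcR er.
move/cvgrPdist_lt/(_ _ e2) : Fa => Fa; move/cvgrPdist_lt/(_ _ e2) : Fb => Fb.
near=> z; rewrite (le_lt_trans (normc_Re_Im_le _))// -er ltcR !raddfB/=.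
by rewrite [ltRHS]splitr ltrD//; near: z.
Unshelve. all: by end_near. Qed.

End complex_complete.

Section dual.
Variables (R : realType) (E : normedModType R[i]).

Definition is_functional : {pred (E -> R[i]^o)} :=
  [pred f : E -> R[i]^o | `[< linear f /\ continuous f >]].

Record dual := Dual {
  dual_fun :> E -> R[i]^o ;
  dual_funP : dual_fun \in is_functional }.

HB.instance Definition _ := [isSub for dual_fun].
HB.instance Definition _ := [Choice of dual by <:].

Lemma is_functional_submod_closed : submod_closed is_functional.
Proof.
split => [|a f g].
  apply/asboolP; split; last exact: cst_continuous.
  by move=> k x y; rewrite -[LHS]/(0 : R[i]^o) -[RHS]/(k *: 0 + 0) scaler0 addr0.
move=> /asboolP[fl fc] /asboolP[gl gc]; apply/asboolP; split.
  move=> k x y; rewrite -[LHS]/(a *: f _ + g _).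
  rewrite -[RHS]/(k *: (a *: f x + g x) + (a *: f y + g y)) fl gl !scalerDr !scalerA addrACA.
  by rewrite (mulrC a k).
by move=> x; apply: cvgD; [apply: cvgZr; exact: fc|exact: gc].
Qed.

HB.instance Definition _ := GRing.isSubmodClosed.Build R[i] (E -> R[i]^o)
  is_functional is_functional_submod_closed.
HB.instance Definition _ := [SubChoice_isSubLmodule of dual by <:].

Lemma dual_linear (f : dual) : linear f.
Proof. by have := dual_funP f; rewrite inE => -[]. Qed.

HB.instance Definition _ (f : dual) :=
  GRing.isLinear.Build R[i] E R[i]^o _ (dual_fun f) (dual_linear f).

Lemma dual_continuous (f : dual) : continuous f.
Proof. by have := dual_funP f; rewrite inE => -[]. Qed.

Lemma dualP (f g : dual) : f =1 g -> f = g.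
Proof. by move=> fg; apply: val_inj; apply/funext. Qed.

Definition dual_norm (f : dual) : R :=
  sup [set complex.Re `|f x| | x in [set x | `|x| <= 1]].

Let ReK (x : R[i]) : 0 <= x -> (complex.Re x)%:C = x.
Proof. by move=> x0; rewrite RRe_real// ger0_real. Qed.

Let le_Re (x y : R[i]) : x <= y -> complex.Re x <= complex.Re y.
Proof. by rewrite lecE => /andP[]. Qed.

Lemma has_sup_dual_norm (f : dual) :
  has_sup [set complex.Re `|f x| | x in [set x | `|x| <= 1]].
Proof.
split; first by exists (complex.Re `|f 0|), 0 => //=; rewrite normr0.
have /bounded_funP/(_ 1)[M fM] :=
  continuous_linear_bounded (0 : E) (@dual_continuous f 0).
by exists (complex.Re M) => _ [x /= x1 <-]; have := le_Re (fM _ x1).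
Qed.

Lemma ler_dual_norm (f : dual) x : `|f x| <= (dual_norm f)%:C * `|x|.
Proof.
have [->|x0] := eqVneq x 0; first by rewrite raddf0 !normr0 mulr0.
have nx : 0 < `|x| by rewrite normr_gt0.
rewrite -ler_pdivrMr// -[`|x|]normr_id -normf_div.
have -> : f x / `|x| = f (`|x|^-1 *: x) by rewrite linearZ mulrC.
rewrite -[leLHS]ReK// lecR; apply: ub_le_sup.
  by have [] := has_sup_dual_norm f.
exists (`|x|^-1 *: x) => //=.
by rewrite normrZ normfV normr_id mulVf// gt_eqF.
Qed.

Lemma dual_norm_le (f : dual) (M : R) : 0 <= M ->
  (forall x, `|f x| <= M%:C * `|x|) -> dual_norm f <= M.
Proof.
move=> M0 fM; apply: ge_sup.
  by exists (complex.Re `|f 0|), 0 => //=; rewrite normr0.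
move=> _ [x x1 <-]; rewrite -lecR. rewrite (ReK (normr_ge0 _)) (le_trans (fM x))//.
by rewrite -[leRHS]mulr1 ler_wpM2l// lecR.
Qed.

Lemma dual_norm_ge0 (f : dual) : 0 <= dual_norm f.
Proof.
apply: ub_le_sup; first by have [] := has_sup_dual_norm f.
exists 0; first by rewrite /= normr0.
by rewrite raddf0 normr0.
Qed.

Lemma dual_normD (f g : dual) :
  (dual_norm (f + g))%:C <= (dual_norm f)%:C + (dual_norm g)%:C.
Proof.
rewrite -rmorphD lecR; apply: dual_norm_le => [|x].
  by rewrite addr_ge0 ?dual_norm_ge0.
rewrite rmorphD mulrDl (le_trans (ler_normD _ _))//.
by rewrite lerD// ler_dual_norm.
Qed.

Let dual_normZ_le (k : R[i]) (f : dual) :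
  (dual_norm (k *: f))%:C <= `|k| * (dual_norm f)%:C.
Proof.
have [r kr] : exists r : R, `|k| = r%:C.
  by exists (complex.Re `|k|); rewrite ReK.
have r0 : 0 <= r by rewrite -ler0c -kr.
rewrite kr -rmorphM lecR; apply: dual_norm_le => [|x].
  by rewrite mulr_ge0 ?dual_norm_ge0.
have -> : (k *: f) x = k * f x by [].
rewrite rmorphM/= -kr normrM -mulrA.
by rewrite ler_wpM2l// ler_dual_norm.
Qed.

Lemma dual_normZ (k : R[i]) (f : dual) :
  (dual_norm (k *: f))%:C = `|k| * (dual_norm f)%:C.
Proof.
have [->|k0] := eqVneq k 0.
  apply/eqP; rewrite eq_le dual_normZ_le/= normr0 mul0r.
  by rewrite ler0c dual_norm_ge0.
apply/eqP; rewrite eq_le dual_normZ_le/=.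
rewrite -ler_pdivlMl ?normr_gt0// -normfV.
by rewrite -{1}[f](scalerK k0); exact: dual_normZ_le.
Qed.

Lemma dual_norm0_eq0 (f : dual) : (dual_norm f)%:C = 0 -> f = 0.
Proof.
move=> f0; apply: dualP => x; apply/eqP; rewrite -normr_le0.
by rewrite (le_trans (ler_dual_norm f x))// f0 mul0r.
Qed.

HB.instance Definition _ := Lmodule_isNormed.Build R[i] dual
  dual_normD dual_normZ dual_norm0_eq0.

Lemma dual_normE (f : dual) : `|f| = (dual_norm f)%:C.
Proof. by []. Qed.

Lemma dual_cauchy_cvg (F : set_system dual) :
  ProperFilter F -> cauchy F -> cvg F.
Proof.
move=> FF /cauchy_ballP Fc.
have Fx x : cvg ((fun f : dual => f x) @ F).
  apply: complex_cauchy_cvg; apply/cauchy_ballP => e e0.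
  have d0 : 0 < e / (`|x| + 1) by rewrite divr_gt0// ltr_wpDl.
  have [[A B] [/= FA FB] AB] := Fc _ d0.
  exists ((fun f : dual => f x) @` A, (fun f : dual => f x) @` B) => /=.
    by split; [apply: filterS FA | apply: filterS FB] => f ?; exists f.
  move=> [_ _] [/= [f Af <-] [g Bg <-]].
  have := AB (f, g) (conj Af Bg); rewrite -!ball_normE/= => fg.
  rewrite (le_lt_trans (ler_dual_norm (f - g) x))// -dual_normE.
  rewrite (@le_lt_trans _ _ (e / (`|x| + 1) * `|x|))//.
    by rewrite ler_wpM2r// ltW.
  by rewrite mulrAC ltr_pdivrMr// ?ltr_pM2l// ?ltrDl// ltr_wpDl.
pose l x := lim ((fun f : dual => f x) @ F) : R[i]^o.
have ll : linear l.
  move=> k x y; apply: (@cvg_lim R[i]^o); first exact: norm_hausdorff.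
  have -> : (fun f : dual => f (k *: x + y)) = (fun f => k *: f x + f y).
    by apply/funext => f; rewrite linearP.
  by apply: cvgD; [apply: cvgZr; exact: Fx|exact: Fx].
have lF (e : R[i]) : 0 < e ->
    \forall f \near F, forall x, `|(f : dual) x - l x| <= e * `|x|.
  move=> e0; have [[A B] [/= FA FB] AB] := Fc _ e0.
  near=> f => x.
  have Af : A f by near: f.
  apply/ler_addgt0Pr => d d0.
  near F => g.
  have Bg : B g by near: g.
  have gl : `|g x - l x| < d.
    by near: g; move/cvgrPdist_lt: (Fx x) => /(_ d d0); under eq_near do rewrite distrC.
  have := AB (f, g) (conj Af Bg); rewrite -ball_normE/= => fg.
  rewrite -(subrKA (g x)) (le_trans (ler_normD _ _))// lerD//; last exact: ltW.
  rewrite (le_trans (ler_dual_norm (f - g) x))// -dual_normE.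
  by rewrite ler_wpM2r// ltW.
have lc : continuous l.
  pose L : {linear E -> R[i]^o} :=
    HB.pack l (GRing.isLinear.Build R[i] E R[i]^o _ l ll).
  apply: (@bounded_linear_continuous _ _ _ L).
  apply/bounded_funP => r; near F => f.
  have fl : forall x, `|f x - l x| <= 1 * `|x| by near: f; exact: lF.
  exists ((`|f| + 1) * r) => x xr.
  rewrite (le_trans _ (ler_wpM2l _ xr))// mulrDl.
  rewrite -(subrK (f x) (L x)) addrC (le_trans (ler_normD _ _))// lerD//.
    exact: ler_dual_norm.
  by rewrite distrC.
have lP : l \in is_functional by rewrite inE.
apply/cvg_ex; exists (Dual lP); apply/cvgrPdist_le => e e0.
near=> f; have fl : forall x, `|f x - l x| <= e * `|x| by near: f; exact: lF.
rewrite distrC dual_normE -(ReK (ltW e0)) lecR; apply: dual_norm_le => [|x].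
  by rewrite -ler0c ReK// ltW.
by rewrite (ReK (ltW e0)); exact: fl.
Unshelve. all: by end_near. Qed.

HB.instance Definition _ := Uniform_isComplete.Build dual dual_cauchy_cvg.

End dual.

Notation bidual E := (dual (dual E)).

Section bidual.
Variables (R : realType) (E : normedModType R[i]).

Lemma evaluation_subproof (x : E) :
  (fun phi : dual E => phi x) \in @is_functional R (dual E).
Proof.
apply/asboolP; have ll : linear (fun phi : dual E => phi x : R[i]^o) by [].
split=> //.
pose L : {linear dual E -> R[i]^o} :=
  HB.pack (fun phi : dual E => phi x : R[i]^o)
    (GRing.isLinear.Build R[i] (dual E) R[i]^o _ _ ll).
apply: (@bounded_linear_continuous _ _ _ L).
apply/bounded_funP => r; exists (r * `|x|) => phi phir.
by rewrite (le_trans (ler_dual_norm phi x))// ler_wpM2r.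
Qed.

Definition evaluation (x : E) : bidual E := Dual (evaluation_subproof x).

End bidual.

Record directedSet := DirectedSet {
  directed_car :> Type ;
  directed_le : directed_car -> directed_car -> Prop ;
  directed_inh : inhabited directed_car ;
  directed_refl : forall i, directed_le i i ;
  directed_trans : forall i j k,
    directed_le i j -> directed_le j k -> directed_le i k ;
  directed_ub : forall i j, exists k, directed_le i k /\ directed_le j k }.

(* A net u : D -> T converges to a point when the filter u @ tails D does. *)
Definition tails (D : directedSet) : set_system D :=
  [set A | exists i, forall j, directed_le i j -> A j].

Arguments tails : clear implicits.

Lemma tails_proper (D : directedSet) : ProperFilter (tails D).
Proof.
split; first by by case=> i /(_ i (directed_refl i)).
split; first by have [k] := directed_inh D; exists k.
- move=> A B [i iA] [j jB]; have [k [ik jk]] := directed_ub i j.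
  exists k => l kl; split; [apply: iA|apply: jB];
  exact: directed_trans kl.
- by move=> A B AB [i iA]; exists i => j /iA /AB.
Qed.

#[export] Existing Instance tails_proper.

Section nets.
Variables (R : realType) (E : normedModType R[i]).

Definition bounded_net (D : directedSet) (u : D -> E) :=
  exists M, forall i, `|u i| <= M.

(* The w^*-topology of the bidual is the topology of pointwise convergence
   on the dual. *)
Definition wstar_cvg (D : directedSet) (u : D -> bidual E) (m : bidual E) :=
  {ptws, (fun i => u i : dual E -> R[i]^o) @ tails D --> (m : dual E -> R[i]^o)}.

(* [iterated_wstar_lim f q] : q = lim_i lim_j lim_k f i j k, the limit over k
   being taken first. *)
Definition iterated_wstar_lim (D1 D2 D3 : directedSet)
    (f : D1 -> D2 -> D3 -> bidual E) (q : bidual E) :=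
  exists (g : D1 -> D2 -> bidual E) (h : D1 -> bidual E),
    [/\ forall i j, wstar_cvg (f i j) (g i j),
        forall i, wstar_cvg (g i) (h i) &
        wstar_cvg h q].

Variable pi : E -> E -> E -> E.

(* [get] selects the element of the bidual which is the iterated limit along
   every choice of nets; it is unique since, by Goldstine's theorem, every
   point of the bidual is the w^*-limit of some bounded net of E. *)
Definition aron_berner0 (m n p : bidual E) : bidual E :=
  get [set q | forall (D1 D2 D3 : directedSet)
      (u : D1 -> E) (v : D2 -> E) (w : D3 -> E),
    bounded_net u -> bounded_net v -> bounded_net w ->
    wstar_cvg (evaluation (E := E) \o u) m ->
    wstar_cvg (evaluation (E := E) \o v) n ->
    wstar_cvg (evaluation (E := E) \o w) p ->
    iterated_wstar_lim (fun i j k => evaluation (pi (u i) (v j) (w k))) q].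

Definition aron_berner2 (m n p : bidual E) : bidual E :=
  get [set q | forall (D1 D2 D3 : directedSet)
      (u : D1 -> E) (v : D2 -> E) (w : D3 -> E),
    bounded_net u -> bounded_net v -> bounded_net w ->
    wstar_cvg (evaluation (E := E) \o u) m ->
    wstar_cvg (evaluation (E := E) \o v) n ->
    wstar_cvg (evaluation (E := E) \o w) p ->
    iterated_wstar_lim (fun k j i => evaluation (pi (u i) (v j) (w k))) q].

End nets.

Definition outer_symmetric (T : Type) (rho : T -> T -> T -> T) :=
  forall m n p, rho m n p = rho p n m.

Record jordan_banach_triple (R : realType) (E : completeNormedModType R[i])
    (pi : E -> E -> E -> E) : Prop := {
  triple_continuous : continuous (fun x : E * E * E => pi x.1.1 x.1.2 x.2) ;
  triple_linear_left : forall b c, linear (fun a => pi a b c) ;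
  triple_conj_linear : forall a c (k : R[i]) x y,
    pi a (k *: x + y) c = k^* *: pi a x c + pi a y c ;
  triple_linear_right : forall a b, linear (fun c => pi a b c) ;
  triple_symmetric : outer_symmetric pi ;
  triple_jordan : forall a b c d e,
    pi a b (pi c d e) =
      pi (pi a b c) d e - pi c (pi b a d) e + pi c d (pi a b e) }.

(* Main.v *)
From HB Require Import structures.
Require Import Defs.
From mathcomp Require Import all_boot all_order all_algebra.
From mathcomp Require Import complex.
From mathcomp Require Import all_classical all_reals all_analysis.
From mathcomp Require Import ring lra.

Set Implicit Arguments.
Unset Strict Implicit.
Unset Printing Implicit Defensive.

Import Order.TTheory GRing.Theory Num.Theory.
Import numFieldNormedType.Exports.

Local Open Scope classical_set_scope.
Local Open Scope ring_scope.
Local Open Scope complex_scope.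

(** Write T for the first extension, the one with the limit over the third
    variable taken first.  It has the closed formula
      T m n p phi = m (x |-> conj (n (y |-> conj (p (z |-> phi (pi x y z)))))),
    called [extension] below, in which both conjugations are there because [pi]
    is conjugate linear in the middle.  Every choice of bounded nets has this
    iterated limit ([extension_iterated_lim]), and there is at least one choice
    of nets by Goldstine's theorem ([goldstine_net]), so the formula is the
    extension ([aron_berner0E]).  Trilinearity and the bound of [pi] are
    inherited through the formula ([extension_bounded]), hence so is joint
    continuity.  Since [pi] is symmetric in the outer variables, the other
    extension is T with its outer arguments exchanged ([aron_berner2E]); both
    agree as soon as one of them is symmetric, which settles every claim about
    the second extension.

    What is left is that symmetry of T implies the Jordan identity
      {a,b,{c,d,e}} = {{a,b,c},d,e} - {c,{b,a,d},e} + {c,d,{a,b,e}}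
    on the bidual ([extension_jordan]).  The identity holds on E, and it extends
    in one variable whenever both sides are weak-star continuous in it, the
    other variables being fixed.  By its formula T m n p is weak-star continuous
    in m, and by symmetry in p.  In n it is weak-star continuous when m belongs
    to E, hence by symmetry when p does, but not in general.  So the order in
    which the variables are released from E to the bidual matters: each of the
    middle slots must still have, when one of its variables is released, a
    neighbour in E.  In the term {c,{b,a,d},e} this asks that a, b and d come
    before one of c and e, and that a come before b or d; in the terms
    {a,b,{c,d,e}} and {c,d,{a,b,e}} it is enough that b come before a and d
    before c, and in {{a,b,c},d,e} that b come before a and d before e.  The
    order b, a, d, c, e meets all the constraints. *)

(** * Functionals and weak-star convergence *)

Section functionals.
Variables (R : realType) (E : normedModType R[i]).

Lemma bounded_functional (f : E -> R[i]^o) (C : R[i]) :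
  linear f -> (forall x, `|f x| <= C * `|x|) -> f \in @is_functional R E.
Proof.
move=> fl fC; apply/asboolP; split=> //.
pose L : {linear E -> R[i]^o} :=
  HB.pack f (GRing.isLinear.Build R[i] E R[i]^o _ _ fl).
apply: (@bounded_linear_continuous _ _ _ L).
apply/bounded_funP => r; exists (`|C| * r) => x xr.
rewrite (le_trans (fC x))// -(ger0_norm (le_trans (normr_ge0 _) (fC x))).
by rewrite normrM normr_id ler_wpM2l.
Qed.

Lemma norm_functional (f : dual E) x : `|f x| <= `|f| * `|x|.
Proof. exact: ler_dual_norm. Qed.

Lemma norm_functional_le (f : dual E) (C : R[i]) :
  0 <= C -> (forall x, `|f x| <= C * `|x|) -> `|f| <= C.
Proof.
move=> C0 fC; have CE : (complex.Re C)%:C = C by rewrite RRe_real// ger0_real.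
rewrite dual_normE -CE lecR; apply: dual_norm_le => [|x]; last by rewrite CE.
by rewrite -ler0c CE.
Qed.

Lemma evaluationE (x : E) (phi : dual E) : evaluation x phi = phi x.
Proof. by []. Qed.

(** Weak-star convergence is only ever tested one functional at a time. *)
Lemma wstar_cvgP (D : directedSet) (u : D -> bidual E) (m : bidual E) :
  wstar_cvg u m <->
  forall phi : dual E,
    (fun i => u i phi : R[i]^o) @ tails D --> (m phi : R[i]^o).
Proof.
rewrite /wstar_cvg.
exact: (@pointwise_cvgP (dual E) R[i]^o
   ((fun i => u i : dual E -> R[i]^o) @ tails D) m _).
Qed.

Lemma wstar_cvg_unique (D : directedSet) (u : D -> bidual E) (m n : bidual E) :
  wstar_cvg u m -> wstar_cvg u n -> m = n.
Proof.
move=> /wstar_cvgP um /wstar_cvgP un; apply: dualP => phi.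
exact: (cvg_unique _ (um phi) (un phi)).
Qed.

Lemma cvg_conj (T : Type) (F : set_system T) (FF : Filter F) (f : T -> R[i]^o)
    (l : R[i]^o) :
  f @ F --> l -> (fun t => Num.conj (f t) : R[i]^o) @ F --> (Num.conj l : R[i]^o).
Proof.
move=> /cvgrPdist_lt fl; apply/cvgrPdist_lt => e /fl; apply: filterS => t.
by rewrite -rmorphB norm_conjC.
Qed.

End functionals.

(** * Bounded triple products *)

(** The part of a Jordan triple structure that passes from a product to its
    extension with no symmetry assumption.  The constant is a parameter so that
    the extension can be seen to inherit it. *)
Record bounded_triple (R : realType) (E : normedModType R[i])
    (pi : E -> E -> E -> E) (K : R[i]) : Prop := {
  bt_linear_left : forall b c, linear (fun a => pi a b c) ;
  bt_conj_linear : forall a c (k : R[i]) x y,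
    pi a (k *: x + y) c = Num.conj k *: pi a x c + pi a y c ;
  bt_linear_right : forall a b, linear (fun c => pi a b c) ;
  bt_ge0 : 0 <= K ;
  bt_le : forall a b c, `|pi a b c| <= K * `|a| * `|b| * `|c| }.

Section bounded_triple.
Variables (R : realType) (E : normedModType R[i]) (pi : E -> E -> E -> E).

(** The increment telescopes, one variable changing at a time:
    {x,y,z} - {a,b,c} = {x-a,y,z} + {a,y-b,z} + {a,b,z-c}. *)
Lemma bounded_triple_continuous (K : R[i]) : bounded_triple pi K ->
  continuous (fun x : E * E * E => pi x.1.1 x.1.2 x.2).
Proof.
move=> [pil pic pir K0 piK] [[a b] c].
have diff x y z : pi x y z - pi a b c =
    pi (x - a) y z + (pi a (y - b) z + pi a b (z - c)).
  have -> : pi (x - a) y z = pi x y z - pi a y z.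
    by rewrite -[in LHS]scaleN1r addrC pil scaleN1r addrC.
  have -> : pi a (y - b) z = pi a y z - pi a b z.
    by rewrite -[in LHS]scaleN1r addrC pic rmorphN1 scaleN1r addrC.
  have -> : pi a b (z - c) = pi a b z - pi a b c.
    by rewrite -[in LHS]scaleN1r addrC pir scaleN1r addrC.
  by rewrite addrA !subrKA.
pose g (x : E * E * E) : R[i]^o := K * `|x.1.1 - a| * `|x.1.2| * `|x.2| +
  (K * `|a| * `|x.1.2 - b| * `|x.2| + K * `|a| * `|b| * `|x.2 - c|).
have c1 : x.1.1 @[x --> (a, b, c)] --> a.
  by apply: (cvg_comp fst fst cvg_fst); exact: cvg_fst.
have c2 : x.1.2 @[x --> (a, b, c)] --> b.
  by apply: (cvg_comp fst snd cvg_fst); exact: cvg_snd.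
have c3 : x.2 @[x --> (a, b, c)] --> c by exact: cvg_snd.
have cN (h : E * E * E -> E) l : h x @[x --> (a, b, c)] --> l ->
    (`|h x| : R[i]^o) @[x --> (a, b, c)] --> (`|l| : R[i]^o) by exact: cvg_norm.
have cB (h : E * E * E -> E) l : h x @[x --> (a, b, c)] --> l ->
    (`|h x - l| : R[i]^o) @[x --> (a, b, c)] --> (0 : R[i]^o).
  by move=> hl; rewrite -(normr0 E) -(subrr l); apply: cN; apply: cvgB => //;
  exact: cvg_cst.
have cst (k : R[i]^o) : (fun _ : E * E * E => k) @ (a, b, c) --> k.
  exact: cvg_cst.
have cM (f h : E * E * E -> R[i]^o) (k l : R[i]^o) :
    f x @[x --> (a, b, c)] --> k -> h x @[x --> (a, b, c)] --> l ->
    (f x * h x : R[i]^o) @[x --> (a, b, c)] --> (k * l : R[i]^o).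
  exact: cvgM.
have cD (f h : E * E * E -> R[i]^o) (k l : R[i]^o) :
    f x @[x --> (a, b, c)] --> k -> h x @[x --> (a, b, c)] --> l ->
    (f x + h x : R[i]^o) @[x --> (a, b, c)] --> (k + l : R[i]^o).
  exact: cvgD.
have cM4 f1 f2 f3 f4 k1 k2 k3 k4 f1k f2k f3k f4k :=
  cM _ f4 _ k4 (cM _ f3 _ k3 (cM f1 f2 k1 k2 f1k f2k) f3k) f4k.
have gc : g x @[x --> (a, b, c)] --> (0 : R[i]^o).
  have -> : 0 = K * 0 * `|b| * `|c| +
      (K * `|a| * 0 * `|c| + K * `|a| * `|b| * 0) :> R[i]^o.
    by rewrite !mulr0 !mul0r !addr0.
  apply: (cD _ _ _ _ (cM4 _ _ _ _ _ _ _ _ (cst K) (cB _ _ c1) (cN _ _ c2) (cN _ _ c3))).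
  apply: (cD _ _ _ _ (cM4 _ _ _ _ _ _ _ _ (cst K) (cst `|a|) (cB _ _ c2) (cN _ _ c3))).
  exact: (cM4 _ _ _ _ _ _ _ _ (cst K) (cst `|a|) (cst `|b|) (cB _ _ c3)).
apply/cvgrPdist_lt => e e0; have /cvgrPdist_lt/(_ _ e0) := gc.
apply: filterS => -[[x y] z]; apply: le_lt_trans.
rewrite sub0r normrN distrC /= diff.
rewrite (le_trans (ler_normD _ _))//.
rewrite (le_trans (lerD (piK _ _ _) (ler_normD _ _)))//.
rewrite (le_trans (lerD (lexx _) (lerD (piK _ _ _) (piK _ _ _))))//.
by rewrite real_ler_norm// ger0_real// !addr_ge0// !mulr_ge0.
Qed.

(** Continuity at 0 alone bounds the product: if it stays below 1 on the ball of
    radius d, rescaling each argument to norm d / 2 gives the constant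
    (d / 2)^-3. *)
Lemma bounded_triple_exists :
  (forall b c, linear (fun a => pi a b c)) ->
  (forall a c (k : R[i]) x y,
    pi a (k *: x + y) c = Num.conj k *: pi a x c + pi a y c) ->
  (forall a b, linear (fun c => pi a b c)) ->
  continuous (fun x : E * E * E => pi x.1.1 x.1.2 x.2) ->
  exists K, bounded_triple pi K.
Proof.
move=> pil pic pir pict.
have pi0l y z : pi 0 y z = 0.
  by have := pil y z 1 0 0; rewrite !scale1r addr0 -[LHS]add0r => /addIr.
have pi0m x z : pi x 0 z = 0.
  by have := pic x z 1 0 0; rewrite rmorph1 !scale1r addr0 -[LHS]add0r => /addIr.
have pi0r x y : pi x y 0 = 0.
  by have := pir x y 1 0 0; rewrite !scale1r addr0 -[LHS]add0r => /addIr.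
have piZl k x y z : pi (k *: x) y z = k *: pi x y z.
  by have := pil y z k x 0; rewrite !addr0 pi0l addr0.
have piZm k x y z : pi x (k *: y) z = Num.conj k *: pi x y z.
  by have := pic x z k y 0; rewrite !addr0 pi0m addr0.
have piZr k x y z : pi x y (k *: z) = k *: pi x y z.
  by have := pir x y k z 0; rewrite !addr0 pi0r addr0.
have /cvgrPdist_lt/(_ _ ltr01) := pict (0, 0, 0).
rewrite /= pi0l => -/nbhs_ballP[d d0 Hd].
have d20 : 0 < d / 2 by rewrite divr_gt0.
have dlt : d / 2 < d by rewrite gtr_pMr// invf_lt1// ltr1n.
have small x : x != 0 -> `|(d / 2 / `|x|) *: x| = d / 2.
  move=> x0; rewrite normrZ normrM normfV normr_id divfK ?normr_eq0//.
  by rewrite gtr0_norm.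
exists ((d / 2) ^- 3); split=> //; first by rewrite invr_ge0 exprn_ge0// ltW.
move=> x y z.
have [->|x0] := eqVneq x 0; first by rewrite pi0l !normr0 mulr0 !mul0r.
have [->|y0] := eqVneq y 0; first by rewrite pi0m !normr0 mulr0 !mul0r.
have [->|z0] := eqVneq z 0; first by rewrite pi0r !normr0 mulr0.
have /Hd : ball ((0 : E), (0 : E), (0 : E)) d
    ((d / 2 / `|x|) *: x, (d / 2 / `|y|) *: y, (d / 2 / `|z|) *: z).
  by do !split; rewrite /= -ball_normE/= sub0r normrN small.
rewrite /= sub0r normrN piZl piZm piZr !scalerA normrZ => /ltW.
have [nx ny nz] : [/\ `|x| != 0, `|y| != 0 & `|z| != 0] by rewrite !normr_eq0.
rewrite !normrM norm_conjC !normrM !normfV !normr_id (gtr0_norm d0) normr_nat => H.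
have -> : (d / 2) ^- 3 * `|x| * `|y| * `|z| =
   (d / 2 / `|x| * (d / 2 / `|y|) * (d / 2 / `|z|))^-1.
  by field; rewrite nx ny nz gt_eqF.
rewrite -[leRHS]mulr1 ler_pdivlMl//.
by rewrite !mulr_gt0// invr_gt0 normr_gt0.
Qed.

End bounded_triple.

(** * The explicit extension to the bidual *)

Section extension.
Variables (R : realType) (E : normedModType R[i]) (pi : E -> E -> E -> E).
Variables (K : R[i]) (piB : bounded_triple pi K).

Let K0 : 0 <= K := bt_ge0 piB.

Lemma right_slice_subproof (phi : dual E) x y :
  (fun z => phi (pi x y z) : R[i]^o) \in @is_functional R E.
Proof.
apply: (@bounded_functional _ _ _ (`|phi| * (K * `|x| * `|y|))) => [k z z'|z].
  by rewrite (bt_linear_right piB) linearP.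
by rewrite (le_trans (norm_functional _ _))// -[leRHS]mulrA ler_wpM2l// (bt_le piB).
Qed.

(** The three slices perform the three limits of the iterated limit, the one
    in the third variable first.  A functional of the bidual can only be applied
    to a linear functional, so the conjugate linear outcome of each stage is
    conjugated before it is packed. *)
Definition right_slice phi x y : dual E := Dual (right_slice_subproof phi x y).

Lemma norm_right_slice phi x y :
  `|right_slice phi x y| <= `|phi| * K * `|x| * `|y|.
Proof.
apply: norm_functional_le => [|z]; first by rewrite !mulr_ge0.
by rewrite (le_trans (norm_functional phi _))// -!mulrA ler_wpM2l//
  !mulrA (bt_le piB).
Qed.

Lemma right_slice_conj_linear phi x k y y' :
  right_slice phi x (k *: y + y') =
    Num.conj k *: right_slice phi x y + right_slice phi x y'.
Proof.
apply: dualP => z; rewrite -[LHS]/(phi (pi x _ z)).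
by rewrite (bt_conj_linear piB) linearP.
Qed.

Lemma right_slice_linear phi y k x x' :
  right_slice phi (k *: x + x') y = k *: right_slice phi x y + right_slice phi x' y.
Proof.
apply: dualP => z; rewrite -[LHS]/(phi (pi _ y z)).
by rewrite (bt_linear_left piB) linearP.
Qed.

Lemma right_slice_linear_functional k phi phi' x y :
  right_slice (k *: phi + phi') x y = k *: right_slice phi x y + right_slice phi' x y.
Proof. exact: dualP. Qed.

Lemma middle_slice_subproof (phi : dual E) (p : bidual E) x :
  (fun y => Num.conj (p (right_slice phi x y)) : R[i]^o) \in @is_functional R E.
Proof.
apply: (@bounded_functional _ _ _ (`|p| * (`|phi| * K * `|x|))) => [k y y'|y].
  by rewrite right_slice_conj_linear linearP rmorphD rmorphM /= conjCK.
rewrite norm_conjC (le_trans (norm_functional _ _))// -[leRHS]mulrA ler_wpM2l//.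
exact: norm_right_slice.
Qed.

Definition middle_slice phi p x : dual E := Dual (middle_slice_subproof phi p x).

Lemma norm_middle_slice phi p x :
  `|middle_slice phi p x| <= `|phi| * K * `|p| * `|x|.
Proof.
apply: norm_functional_le => [|y]; first by rewrite !mulr_ge0.
rewrite norm_conjC (le_trans (norm_functional p _))//.
rewrite (le_trans (ler_wpM2l _ (norm_right_slice _ _ _)))//.
by rewrite le_eqVlt; apply/orP; left; apply/eqP; ring.
Qed.

Lemma middle_slice_conj_linear phi p k x x' :
  middle_slice phi p (k *: x + x') =
    Num.conj k *: middle_slice phi p x + middle_slice phi p x'.
Proof.
apply: dualP => y; rewrite -[LHS]/(Num.conj (p (right_slice phi _ y))).
by rewrite right_slice_linear linearP rmorphD rmorphM.
Qed.

Lemma middle_slice_conj_linear_functional p x k phi phi' :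
  middle_slice (k *: phi + phi') p x =
    Num.conj k *: middle_slice phi p x + middle_slice phi' p x.
Proof.
apply: dualP => y; rewrite -[LHS]/(Num.conj (p (right_slice _ x y))).
by rewrite right_slice_linear_functional linearP rmorphD rmorphM.
Qed.

Lemma middle_slice_conj_linear_bidual phi x k p p' :
  middle_slice phi (k *: p + p') x =
    Num.conj k *: middle_slice phi p x + middle_slice phi p' x.
Proof.
by apply: dualP => y; rewrite -[LHS]/(Num.conj (k * _ + _)) rmorphD rmorphM.
Qed.

Lemma left_slice_subproof (phi : dual E) (p n : bidual E) :
  (fun x => Num.conj (n (middle_slice phi p x)) : R[i]^o) \in @is_functional R E.
Proof.
apply: (@bounded_functional _ _ _ (`|n| * (`|phi| * K * `|p|))) => [k x x'|x].
  by rewrite middle_slice_conj_linear linearP rmorphD rmorphM /= conjCK.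
rewrite norm_conjC (le_trans (norm_functional _ _))// -[leRHS]mulrA ler_wpM2l//.
exact: norm_middle_slice.
Qed.

Definition left_slice phi p n : dual E := Dual (left_slice_subproof phi p n).

Lemma norm_left_slice phi p n : `|left_slice phi p n| <= K * `|n| * `|p| * `|phi|.
Proof.
apply: norm_functional_le => [|x]; first by rewrite !mulr_ge0.
rewrite norm_conjC (le_trans (norm_functional n _))//.
rewrite (le_trans (ler_wpM2l _ (norm_middle_slice _ _ _)))//.
by rewrite le_eqVlt; apply/orP; left; apply/eqP; ring.
Qed.

Lemma left_slice_linear_functional p n k phi phi' :
  left_slice (k *: phi + phi') p n = k *: left_slice phi p n + left_slice phi' p n.
Proof.
apply: dualP => x; rewrite -[LHS]/(Num.conj (n (middle_slice _ p x))).
by rewrite middle_slice_conj_linear_functional linearP rmorphD rmorphM /= conjCK.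
Qed.

Lemma left_slice_linear_right phi n k p p' :
  left_slice phi (k *: p + p') n = k *: left_slice phi p n + left_slice phi p' n.
Proof.
apply: dualP => x; rewrite -[LHS]/(Num.conj (n (middle_slice _ _ x))).
by rewrite middle_slice_conj_linear_bidual linearP rmorphD rmorphM /= conjCK.
Qed.

Lemma left_slice_conj_linear phi p k n n' :
  left_slice phi p (k *: n + n') =
    Num.conj k *: left_slice phi p n + left_slice phi p n'.
Proof.
by apply: dualP => x; rewrite -[LHS]/(Num.conj (k * _ + _)) rmorphD rmorphM.
Qed.

Lemma extension_subproof (m n p : bidual E) :
  (fun phi => m (left_slice phi p n) : R[i]^o) \in @is_functional R (dual E).
Proof.
apply: (@bounded_functional _ _ _ (`|m| * (K * `|n| * `|p|))) => [k phi phi'|phi].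
  by rewrite left_slice_linear_functional linearP.
rewrite (le_trans (norm_functional _ _))// -[leRHS]mulrA ler_wpM2l//.
exact: norm_left_slice.
Qed.

Definition extension m n p : bidual E := Dual (extension_subproof m n p).

Lemma extension_bounded : bounded_triple extension K.
Proof.
split=> //.
- by move=> n p k m m'; apply: dualP.
- move=> m p k n n'; apply: dualP => phi.
  by rewrite -[LHS]/(m (left_slice phi p _)) left_slice_conj_linear linearP.
- move=> m n k p p'; apply: dualP => phi.
  by rewrite -[LHS]/(m (left_slice phi _ n)) left_slice_linear_right linearP.
move=> m n p; apply: norm_functional_le => [|phi]; first by rewrite !mulr_ge0.
rewrite (le_trans (norm_functional m _))//.
rewrite (le_trans (ler_wpM2l _ (norm_left_slice _ _ _)))//.
by rewrite le_eqVlt; apply/orP; left; apply/eqP; ring.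
Qed.

Lemma extension_evaluation x y z :
  extension (evaluation x) (evaluation y) (evaluation z) = evaluation (pi x y z).
Proof.
by apply: dualP => phi; rewrite -[LHS]/(Num.conj (Num.conj _)) conjCK.
Qed.

(** Each of the three limits applies the hypothesis on a net to one slice; the
    two intermediate limits are the values of the extension with one or two
    arguments in E. *)
Lemma extension_iterated_lim (D1 D2 D3 : directedSet)
    (u : D1 -> E) (v : D2 -> E) (w : D3 -> E) (m n p : bidual E) :
  wstar_cvg (evaluation (E := E) \o u) m ->
  wstar_cvg (evaluation (E := E) \o v) n ->
  wstar_cvg (evaluation (E := E) \o w) p ->
  iterated_wstar_lim (fun i j k => evaluation (pi (u i) (v j) (w k)))
    (extension m n p).
Proof.
move=> /wstar_cvgP um /wstar_cvgP vn /wstar_cvgP wp.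
exists (fun i j => extension (evaluation (u i)) (evaluation (v j)) p).
exists (fun i => extension (evaluation (u i)) n p).
split=> [i j|i|]; apply/wstar_cvgP => phi.
- rewrite -[X in _ --> X]
    /(Num.conj (Num.conj (p (right_slice phi (u i) (v j))))).
  by rewrite conjCK; exact: wp.
- by apply: cvg_conj; exact: vn.
- exact: um.
Qed.

End extension.

(** * Goldstine's theorem *)

Section goldstine.
Variables (R : realType) (E : normedModType R[i]).

Definition sqnorm (z : R[i]) : R := complex.Re z ^+ 2 + complex.Im z ^+ 2.

Lemma sqnormE (z : R[i]) : (sqnorm z)%:C = `|z| ^+ 2.
Proof. by rewrite normc_def -rmorphXn /= sqr_sqrtr// addr_ge0// sqr_ge0. Qed.

Lemma sqnorm_ge0 z : 0 <= sqnorm z.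
Proof. by rewrite addr_ge0// sqr_ge0. Qed.

(** The expansion of a squared distance along a segment, from which the
    optimality condition of a least squares problem is read off. *)
Lemma sqnormB (a b : R[i]) (t : R) :
  sqnorm (a - t%:C * b) =
  sqnorm a - t * (2 * complex.Re (Num.conj a * b)) + t ^+ 2 * sqnorm b.
Proof. by case: a b => [a1 a2] [b1 b2]; rewrite /sqnorm /=; ring. Qed.

Lemma dual_sumE (I : Type) (s : seq I) (c : I -> dual E) x :
  (\sum_(i <- s) c i) x = \sum_(i <- s) c i x.
Proof.
by elim: s => [|i s IHs]; rewrite ?big_nil ?big_cons// -IHs.
Qed.

(** A bound on the real part of [psi] over a ball centred at 0 bounds the norm
    of [psi], since multiplying a vector by a phase makes its image a
    nonnegative number. *)
Lemma bidual_Re_le (m : bidual E) (psi : dual E) (A : R) :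
  (forall y, `|y| <= `|m| -> complex.Re (psi y) <= A) ->
  complex.Re (m psi) <= A.
Proof.
move=> psiA.
have A0 : 0 <= A by have := psiA 0; rewrite normr0 linear0; apply.
have Re_le (z : R[i]) : `|z| <= A%:C -> complex.Re z <= A.
  move=> zA; rewrite (le_trans (ler_norm _))// -lecR.
  exact: le_trans (normc_ge_Re _) zA.
apply: Re_le; apply: (le_trans (norm_functional m psi)).
have [->|m0] := eqVneq `|m| 0; first by rewrite mul0r ler0c.
have m_gt0 : 0 < `|m| by rewrite lt_neqAle eq_sym m0 /=.
rewrite mulrC -ler_pdivlMr//; apply: norm_functional_le => [|x].
  by rewrite divr_ge0// ler0c.
have [x0|x0] := eqVneq (psi x) 0.
  by rewrite x0 normr0 mulr_ge0// divr_ge0// ler0c.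
have xn0 : `|x| != 0.
  by rewrite normr_eq0; apply: contraNneq x0 => ->; rewrite linear0.
have px : `|psi x| != 0 by rewrite normr_eq0.
pose k : R[i] := Num.conj (psi x) / `|psi x| * (`|m| / `|x|).
have psik : psi (k *: x) = `|psi x| * (`|m| / `|x|).
  rewrite linearZ /= /k -[LHS]/(_ * _ * psi x).
  rewrite mulrAC; congr (_ * _); apply: (mulIf px).
  by rewrite mulrAC divfK// -expr2 normCKC.
have : complex.Re (psi (k *: x)) <= A.
  apply: psiA; rewrite normrZ /k !normrM !normfV !normr_id norm_conjC.
  by rewrite divff// mul1r divfK.
rewrite psik -lecR RRe_real; last by rewrite ger0_real// mulr_ge0// divr_ge0.
rewrite mulrA ler_pdivrMr ?lt_neqAle 1?eq_sym ?xn0//= => H.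
by rewrite mulrAC ler_pdivlMr.
Qed.

Variable m : bidual E.

(* The squared distance from the values of m to those of x, on finitely many
   functionals; minimizing it over a ball replaces the separation theorem. *)
Let dist_sq (s : seq (dual E)) (x : E) : R :=
  \sum_(phi <- s) sqnorm (m phi - phi x).

(* Up to a factor -2, the real part of this functional is the derivative of
   the squared distance at x. *)
Let gradient (s : seq (dual E)) (x : E) : dual E :=
  \sum_(phi <- s) Num.conj (m phi - phi x) *: phi.

Let gradientE s x y : gradient s x y =
  \sum_(phi <- s) Num.conj (m phi - phi x) * phi y.
Proof. by rewrite dual_sumE. Qed.

Let Re_gradient s x :
  complex.Re (m (gradient s x)) = complex.Re (gradient s x x) + dist_sq s x.
Proof.
have -> : dist_sq s x = complex.Re (\sum_(phi <- s)
    Num.conj (m phi - phi x) * (m phi - phi x)).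
  rewrite raddf_sum /=; apply: eq_bigr => phi _.
  by rewrite -normCKC -sqnormE.
rewrite -raddfD /= gradientE -big_split /= linear_sum; congr complex.Re.
by apply: eq_bigr => phi _; rewrite linearZ /= -mulrDr subrKC.
Qed.

Let dist_sq_move s x y t : dist_sq s (x + t%:C *: (y - x)) =
  dist_sq s x - t * (2 * complex.Re (gradient s x (y - x))) +
    t ^+ 2 * \sum_(phi <- s) sqnorm (phi (y - x)).
Proof.
rewrite gradientE raddf_sum /= !mulr_sumr -sumrB -big_split /=.
apply: eq_bigr => phi _; rewrite -sqnormB; congr sqnorm.
by rewrite [x + _]addrC linearP /= opprD addrCA [LHS]addrC addrAC.
Qed.

(** Otherwise the squared distance I between m and the ball of radius |m| in E,
    measured on the functionals of [s], is positive.  Take a point x of the ball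
    that minimizes it up to t^2.  Moving from x towards any y of the ball by the
    fraction t gains at most t^2, so the gradient at y exceeds its value at x by
    at most a multiple of t; by [bidual_Re_le] the same holds for its value at
    m, and [Re_gradient] says that this excess is at least I, which is absurd
    for small t. *)
Lemma goldstine (s : seq (dual E)) (e : R) : 0 < e ->
  exists x : E, `|x| <= `|m| /\ {in s, forall phi, `|m phi - phi x| < e%:C}.
Proof.
move=> e0; apply: contrapT => noapprox.
pose D := [set dist_sq s x | x in [set x : E | `|x| <= `|m|]].
have D0 : D !=set0 by exists (dist_sq s 0), 0 => //=; rewrite normr0.
have Dge x : `|x| <= `|m| -> e ^+ 2 <= dist_sq s x.
  move=> xm; apply: contrapT => /negP; rewrite -ltNge => lte.
  apply: noapprox; exists x; split=> // phi phis.
  have phile : sqnorm (m phi - phi x) <= dist_sq s x.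
    rewrite /dist_sq (big_rem phi)//= lerDl sumr_ge0// => psi _.
    exact: sqnorm_ge0.
  rewrite -(@ltr_pXn2r _ 2)// ?nnegrE ?ler0c ?ltW//.
  by rewrite -sqnormE -rmorphXn ltcR (le_lt_trans phile).
have Dlb : has_lbound D by exists (e ^+ 2) => _ [x /= xm <-]; exact: Dge.
pose I := inf D.
have I0 : 0 < I.
  apply: (@lt_le_trans _ _ (e ^+ 2)); first by rewrite exprn_gt0.
  by apply: lb_le_inf => // _ [x /= xm <-]; exact: Dge.
have ID x : `|x| <= `|m| -> I <= dist_sq s x.
  by move=> xm; apply: ge_inf => //; exists x.
have [B B0 sB] : exists2 B, 0 <= B & forall x y, `|x| <= `|m| -> `|y| <= `|m| ->
    \sum_(phi <- s) sqnorm (phi (y - x)) <= B.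
  pose b (phi : dual E) : R[i] := (`|phi| * (`|m| + `|m|)) ^+ 2.
  have b0 phi : 0 <= b phi by rewrite exprn_ge0// mulr_ge0// addr_ge0.
  have bE phi : (complex.Re (b phi))%:C = b phi by rewrite RRe_real// ger0_real.
  exists (\sum_(phi <- s) complex.Re (b phi)).
    by apply: sumr_ge0 => phi _; rewrite -lecR bE.
  move=> x y xm ym; apply: ler_sum => phi _; rewrite -lecR sqnormE bE.
  rewrite lerXn2r ?nnegrE// ?mulr_ge0 ?addr_ge0//.
  rewrite (le_trans (norm_functional _ _))// ler_wpM2l//.
  by rewrite (le_trans (ler_normB _ _))// lerD.
(* With this step t is at most 1, and the excess t * (1 + B) / 2 is at most
   I / 2. *)
pose t := I / (1 + B + I).
have t0 : 0 < t by rewrite divr_gt0// ltr_wpDl// addr_ge0.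
have t1 : t <= 1.
  by rewrite ler_pdivrMr ?mul1r ?lerDr ?addr_ge0// ltr_wpDl// addr_ge0.
have tI : t * (1 + B) <= I.
  by rewrite mulrAC ler_pdivrMr ?ltr_wpDl ?addr_ge0// ler_pM2l// lerDl ltW.
have [_ [x /= xm <-] xI] : exists2 d, D d & d < I + t ^+ 2.
  by apply: inf_adherent => //; rewrite exprn_gt0.
have grad y : `|y| <= `|m| -> complex.Re (gradient s x y) <=
    complex.Re (gradient s x x) + I / 2.
  move=> ym.
  have zm : `|x + t%:C *: (y - x)| <= `|m|.
    have -> : x + t%:C *: (y - x) = (1 - t)%:C *: x + t%:C *: y.
      by rewrite rmorphB /= scalerBl scalerBr scale1r addrA addrAC.
    rewrite (le_trans (ler_normD _ _))// !normrZ.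
    rewrite !ger0_norm ?ler0c ?subr_ge0 ?(ltW t0)//.
    have -> : `|m| = (1 - t)%:C * `|m| + t%:C * `|m|.
      by rewrite -mulrDl -rmorphD /= subrK mul1r.
    by rewrite lerD// ler_wpM2l// ler0c ?subr_ge0// ltW.
  have := ID _ zm; rewrite dist_sq_move linearB raddfB /=.
  have := sB _ _ xm ym; set S := \sum_(_ <- _) _ => SB H.
  have : t ^+ 2 * S <= t ^+ 2 * B by rewrite ler_wpM2l// sqr_ge0.
  nra.
have := bidual_Re_le grad; rewrite Re_gradient.
by have := ID _ xm; lra.
Qed.

End goldstine.

Section nets.
Variables (R : realType) (E : normedModType R[i]).

Lemma approximation_trans (x y z : seq (dual E) * nat) :
  {subset x.1 <= y.1} /\ (x.2 <= y.2)%N ->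
  {subset y.1 <= z.1} /\ (y.2 <= z.2)%N ->
  {subset x.1 <= z.1} /\ (x.2 <= z.2)%N.
Proof.
move=> [xy1 xy2] [yz1 yz2]; split; last exact: leq_trans yz2.
by move=> phi /xy1 /yz1.
Qed.

Lemma approximation_ub (x y : seq (dual E) * nat) :
  exists z : seq (dual E) * nat,
    ({subset x.1 <= z.1} /\ (x.2 <= z.2)%N) /\
    ({subset y.1 <= z.1} /\ (y.2 <= z.2)%N).
Proof.
exists (x.1 ++ y.1, maxn x.2 y.2).
by do !split; rewrite ?leq_maxl ?leq_maxr// => phi;
  rewrite mem_cat => ->; rewrite ?orbT.
Qed.

(** Finite sets of functionals together with a precision 1 / (n + 1): the
    weak-star neighbourhoods of a point, without reference to the point. *)
Definition approximation_index : directedSet :=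
  @DirectedSet (seq (dual E) * nat)
    (fun x y => {subset x.1 <= y.1} /\ (x.2 <= y.2)%N)
    (inhabits ([::], 0%N)) (fun x => conj (fun _ h => h) (leqnn _))
    approximation_trans approximation_ub.

Lemma goldstine_net (m : bidual E) : exists (D : directedSet) (u : D -> E),
  bounded_net u /\ wstar_cvg (evaluation (E := E) \o u) m.
Proof.
have /choice[u uP] (i : approximation_index) : exists x : E, `|x| <= `|m| /\
    {in i.1, forall phi, `|m phi - phi x| < (i.2.+1%:R^-1)%:C}.
  by apply: goldstine; rewrite invr_gt0.
exists approximation_index, u; split; first by exists `|m| => i; case: (uP i).
apply/wstar_cvgP => phi; apply/cvgrPdist_lt => e e0.
have eE : (complex.Re e)%:C = e by rewrite RRe_real// gtr0_real.
have e'0 : 0 < complex.Re e by rewrite -ltcR eE.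
have [n nP] : exists n, n.+1%:R^-1 < complex.Re e.
  exists (Num.truncn (complex.Re e)^-1); rewrite invf_plt ?posrE//.
  exact: truncnS_gt.
exists ([:: phi], n) => -[s k] /= [/(_ phi (mem_head _ _)) phis nk].
have [_ /(_ phi phis)] := uP (s, k); move/lt_trans; apply.
rewrite -eE ltcR (le_lt_trans _ nP)// lef_pV2 ?posrE// ler_nat.
exact: nk.
Qed.

Lemma iterated_wstar_lim_unique (D1 D2 D3 : directedSet)
    (f : D1 -> D2 -> D3 -> bidual E) (q r : bidual E) :
  iterated_wstar_lim f q -> iterated_wstar_lim f r -> q = r.
Proof.
move=> [g [h [fg gh hq]]] [g' [h' [fg' gh' hr]]].
have gg' : g = g'.
  by apply/funext => i; apply/funext => j; exact: wstar_cvg_unique (fg i j) (fg' i j).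
subst g'; have hh' : h = h'.
  by apply/funext => i; exact: wstar_cvg_unique (gh i) (gh' i).
by subst h'; exact: wstar_cvg_unique hq hr.
Qed.

(** Goldstine's theorem is what makes the iterated limit unique: nets that
    converge to the three arguments do exist, so a candidate is compared with
    the formula along them. *)
Lemma aron_berner0E (pi : E -> E -> E -> E) (K : R[i])
    (piB : bounded_triple pi K) :
  aron_berner0 pi = extension piB.
Proof.
apply/funext => m; apply/funext => n; apply/funext => p.
apply: get_unique => [D1 D2 D3 u v w _ _ _|q qP].
  exact: extension_iterated_lim.
have [D1 [u [bu um]]] := goldstine_net m.
have [D2 [v [bv vn]]] := goldstine_net n.
have [D3 [w [bw wp]]] := goldstine_net p.
apply: iterated_wstar_lim_unique (qP _ _ _ _ _ _ bu bv bw um vn wp) _.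
exact: extension_iterated_lim.
Qed.

(** Exchanging the outer arguments of [pi] turns the defining condition of one
    extension into that of the other. *)
Lemma aron_berner2E (pi : E -> E -> E -> E) (m n p : bidual E) :
  outer_symmetric pi -> aron_berner2 pi m n p = aron_berner0 pi p n m.
Proof.
move=> pisym; congr get; apply/seteqP.
by split=> q qP D1 D2 D3 u v w bu bv bw um vn wp;
  have := qP _ _ _ w v u bw bv bu wp vn um; congr iterated_wstar_lim;
  do 3![apply/funext => ?]; rewrite pisym.
Qed.

End nets.

(** * Weak-star continuity and the Jordan identity *)

Section preadjoint.
Variables (R : realType) (E : normedModType R[i]).

(** Weak-star continuous linear and conjugate linear maps are treated together;
    the boolean says whether the map is conjugate linear, and composition adds
    the booleans modulo 2. *)
Definition conj_if (b : bool) (z : R[i]) : R[i] := if b then Num.conj z else z.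

Lemma conj_ifD b : {morph conj_if b : y z / y + z}.
Proof. by case: b => y z //; exact: rmorphD. Qed.

Lemma conj_ifN b : {morph conj_if b : z / - z}.
Proof. by case: b => z //; exact: rmorphN. Qed.

Lemma conj_ifK b : involutive (conj_if b).
Proof. by case: b => z //; exact: conjCK. Qed.

(** A linear map is weak-star continuous exactly when it is the adjoint of a map
    of the predual; this algebraic form of weak-star continuity spares all
    limits in the density arguments. *)
Definition preadjoint (b : bool) (T : bidual E -> bidual E) :=
  forall phi : dual E, exists psi : dual E,
    forall m, T m phi = conj_if b (m psi).

Lemma preadjoint_comp b c S T :
  preadjoint b S -> preadjoint c T -> preadjoint (b (+) c) (S \o T).
Proof.
move=> hS hT phi; have [psi Spsi] := hS phi; have [chi Tchi] := hT psi.
exists chi => m; rewrite /= Spsi Tchi.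
by case: b c {hS hT Spsi Tchi} => -[] //=; rewrite conjCK.
Qed.

Lemma preadjointD b S T :
  preadjoint b S -> preadjoint b T -> preadjoint b (fun m => S m + T m).
Proof.
move=> hS hT phi; have [psi Spsi] := hS phi; have [chi Tchi] := hT phi.
by exists (psi + chi) => m; rewrite linearD conj_ifD -Spsi -Tchi.
Qed.

Lemma preadjointN b T : preadjoint b T -> preadjoint b (fun m => - T m).
Proof.
move=> hT phi; have [chi Tchi] := hT phi.
by exists (- chi) => m; rewrite linearN conj_ifN -Tchi.
Qed.

(** This is the weak-star density of E: two such maps that agree on E pull each
    functional back to the same functional. *)
Lemma preadjoint_eq b S T : preadjoint b S -> preadjoint b T ->
  (forall x, S (evaluation x) = T (evaluation x)) -> S =1 T.
Proof.
move=> hS hT ST m; apply: dualP => phi.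
have [psi Spsi] := hS phi; have [chi Tchi] := hT phi.
rewrite Spsi Tchi; congr (conj_if b (m _)); apply: dualP => x.
apply: (can_inj (conj_ifK b)).
rewrite -[psi x]/(evaluation x psi) -[chi x]/(evaluation x chi).
by rewrite -Spsi -Tchi ST.
Qed.

End preadjoint.

Section jordan.
Variables (R : realType) (E : normedModType R[i]) (pi : E -> E -> E -> E).
Variables (K : R[i]) (piB : bounded_triple pi K).

Local Notation T := (extension piB).
Local Notation ev := (evaluation (E := E)).

Lemma preadjoint_left n p : preadjoint false (fun m => T m n p).
Proof. by move=> phi; exists (left_slice piB phi p n). Qed.

Lemma preadjoint_middle_left x p : preadjoint true (fun n => T (ev x) n p).
Proof. by move=> phi; exists (middle_slice piB phi p x). Qed.

(** The variables are released from E in the order b, a, d, c, e.  At each step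
    both sides are compositions of maps that are weak-star continuous in the
    released variable: an outer slot always is, and a middle slot is whenever
    one of its neighbours is still in E. *)
Lemma extension_jordan :
  (forall a b c d e, pi a b (pi c d e) =
     pi (pi a b c) d e - pi c (pi b a d) e + pi c d (pi a b e)) ->
  outer_symmetric T ->
  forall a b c d e,
    T a b (T c d e) = T (T a b c) d e - T c (T b a d) e + T c d (T a b e).
Proof.
move=> piJ Tsym.
have left := preadjoint_left; have midl := preadjoint_middle_left.
have right m n : preadjoint false (T m n).
  by have := left n m; congr preadjoint; apply/funext => p; rewrite Tsym.
have midr m z : preadjoint true (fun n => T m n (ev z)).
  by have := midl z m; congr preadjoint; apply/funext => n; rewrite Tsym.
have sum3 b X Y Z : preadjoint b X -> preadjoint b Y -> preadjoint b Z ->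
    preadjoint b (fun m => X m - Y m + Z m).
  by move=> hX hY hZ; do 2![apply: preadjointD => //]; exact: preadjointN.
(* J0 is the identity in E; the later letter names the variable that has just
   been released. *)
have J0 a b c d e : T (ev a) (ev b) (T (ev c) (ev d) (ev e)) =
    T (T (ev a) (ev b) (ev c)) (ev d) (ev e) -
    T (ev c) (T (ev b) (ev a) (ev d)) (ev e) +
    T (ev c) (ev d) (T (ev a) (ev b) (ev e)).
  rewrite !extension_evaluation piJ; apply: dualP => phi.
  by rewrite evaluationE linearD linearB.
have Jb a c d e b : T (ev a) b (T (ev c) (ev d) (ev e)) =
    T (T (ev a) b (ev c)) (ev d) (ev e) -
    T (ev c) (T b (ev a) (ev d)) (ev e) +
    T (ev c) (ev d) (T (ev a) b (ev e)).
  move: b; apply: (@preadjoint_eq _ _ true) => [||b'];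
    last exact: J0 a b' c d e.
    exact: midl.
  apply: sum3.
  - exact: preadjoint_comp (left _ _) (midl _ _).
  - exact: preadjoint_comp (midl _ _) (left _ _).
  - exact: preadjoint_comp (right _ _) (midl _ _).
have Ja b c d e a : T a b (T (ev c) (ev d) (ev e)) =
    T (T a b (ev c)) (ev d) (ev e) -
    T (ev c) (T b a (ev d)) (ev e) +
    T (ev c) (ev d) (T a b (ev e)).
  move: a; apply: (@preadjoint_eq _ _ false) => [||a'];
    last exact: Jb a' c d e b.
    exact: left.
  apply: sum3.
  - exact: preadjoint_comp (left _ _) (left _ _).
  - exact: preadjoint_comp (midl _ _) (midr _ _).
  - exact: preadjoint_comp (right _ _) (left _ _).
have Jd a b c e d : T a b (T (ev c) d (ev e)) =
    T (T a b (ev c)) d (ev e) -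
    T (ev c) (T b a d) (ev e) +
    T (ev c) d (T a b (ev e)).
  move: d; apply: (@preadjoint_eq _ _ true) => [||d'];
    last exact: Ja b c d' e a.
    exact: preadjoint_comp (right _ _) (midl _ _).
  apply: sum3.
  - exact: midr.
  - exact: preadjoint_comp (midl _ _) (right _ _).
  - exact: midl.
have Jc a b d e c : T a b (T c d (ev e)) =
    T (T a b c) d (ev e) - T c (T b a d) (ev e) + T c d (T a b (ev e)).
  move: c; apply: (@preadjoint_eq _ _ false) => [||c'];
    last exact: Jd a b c' e d.
    exact: preadjoint_comp (right _ _) (left _ _).
  apply: sum3.
  - exact: preadjoint_comp (left _ _) (right _ _).
  - exact: left.
  - exact: left.
move=> a b c d; apply: (@preadjoint_eq _ _ false) => [||e'];
  last exact: Jc a b d e' c.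
  exact: preadjoint_comp (right _ _) (right _ _).
apply: sum3.
- exact: right.
- exact: right.
- exact: preadjoint_comp (right _ _) (right _ _).
Qed.

End jordan.

Theorem theorem3p7 (R : realType) (E : completeNormedModType R[i])
    (pi : E -> E -> E -> E) (Hpi : jordan_banach_triple pi) :
  [/\ outer_symmetric (aron_berner0 pi) <->
        jordan_banach_triple (E := bidual E) (aron_berner0 pi),
      outer_symmetric (aron_berner0 pi) <-> outer_symmetric (aron_berner2 pi) &
      jordan_banach_triple (E := bidual E) (aron_berner0 pi) <->
        jordan_banach_triple (E := bidual E) (aron_berner2 pi)].
Proof.
have [pict pil pic pir pisym piJ] := Hpi.
have [K piB] := bounded_triple_exists pil pic pir pict.
have ab2 m n p := aron_berner2E m n p pisym.
have sym02 : outer_symmetric (aron_berner0 pi) ->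
    aron_berner2 pi = aron_berner0 pi.
  by move=> sym; do 3![apply/funext => ?]; rewrite ab2 sym.
have sym20 : outer_symmetric (aron_berner2 pi) ->
    outer_symmetric (aron_berner0 pi).
  by move=> sym m n p; rewrite -!ab2.
split.
- split=> [|[]//]; rewrite (aron_berner0E piB) => sym.
  have extB := extension_bounded piB; have [extl extc extr _ _] := extB.
  split=> //; first exact: bounded_triple_continuous extB.
  exact: extension_jordan.
- by split=> [sym|]; [rewrite sym02|exact: sym20].
- split=> jbt; first by rewrite sym02//; exact: triple_symmetric jbt.
  by rewrite -sym02//; apply: sym20; exact: triple_symmetric jbt.
Qed.
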